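(* Let $\mathbb{T}$ be a time scale with $1\in\mathbb{T}$ that contains at least one $t$ with $0<t\neq 1$. Let $a\in\mathbb{T}$ with $a>0$, and let $b$ be a positive real number such that $ab\in\mathbb{T}$. Then $$L_{\mathbb{T}}(ab)=L_{\mathbb{T}}(a)+L_{\mathbb{T}/a}(b),$$ where $\mathbb{T}/a=\{t/a : t\in\mathbb{T}\}$.
   Context: A time scale is a nonempty closed subset $\mathbb{T}$ of $\mathbb{R}$. Forward and backward jumps: $\sigma(t)=\inf\{s\in\mathbb{T}:s>t\}$ (with $\inf\emptyset=\sup\mathbb{T}$) and $\rho(t)=\sup\{s\in\mathbb{T}:s<t\}$ (with $\sup\emptyset=\inf\mathbb{T}$). $\mathbb{T}^\kappa$ is $\mathbb{T}$ with its maximum $M$ removed if $M$ exists and is left-scattered ($\rho(M)<M$); otherwise $\mathbb{T}^\kappa=\mathbb{T}$. The delta derivative $f^\Delta(t)$ of $f:\mathbb{T}\to\mathbb{R}$ at $t\in\mathbb{T}^\kappa$ is the number (if it exists) such that for every $\varepsilon>0$ there is a neighbourhood $U$ of $t$ with $|f(\sigma(t))-f(s)-f^\Delta(t)(\sigma(t)-s)|\le\varepsilon|\sigma(t)-s|$ for all $s\in U\cap\mathbb{T}$. For $a\le b$ in $\mathbb{T}$ and $f$ continuous on $\mathbb{T}\cap[a,b]$, the delta integral is $\int_a^b f(\tau)\,\Delta\tau=F(b)-F(a)$, where $F$ satisfies $F^\Delta=f$ on $(\mathbb{T}\cap[a,b])^\kappa$ (delta calculus on the time scale $\mathbb{T}\cap[a,b]$);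 and $\int_b^a f\,\Delta\tau=-\int_a^b f\,\Delta\tau$. For a time scale $\mathbb{T}$ with $1\in\mathbb{T}$ that contains at least one $t$ with $0<t\ne1$, the natural logarithm on $\mathbb{T}$ is $$L_{\mathbb{T}}(t)=\int_1^t\frac1\tau\,\Delta\tau,\qquad t\in\mathbb{T}\cap(0,+\infty),$$ the delta integral being taken on $\mathbb{T}$. Thus $L_{\mathbb{T}/a}$ is the analogous integral taken on the time scale $\mathbb{T}/a$, which contains $1$ and $b$. *)

(* Defs.v *)
From mathcomp Require Import all_boot all_order all_algebra.
From mathcomp Require Import all_classical all_reals all_analysis.
Set Implicit Arguments.
Unset Strict Implicit.
Unset Printing Implicit Defensive.
Import Order.TTheory GRing.Theory Num.Theory.
Import numFieldNormedType.Exports.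
Local Open Scope classical_set_scope.
Local Open Scope ring_scope.

(* A function on a time scale T is represented by a function R -> R of which
   only the values on T matter. *)

Definition time_scale (R : realType) (T : set R) : Prop :=
  T !=set0 /\ closed T.

(* The [sup T] branch is only reached when t bounds T from above, so that for
   a nonempty T the library's default value of [sup] is never used; dually for
   [backward_jump]. *)
Definition forward_jump (R : realType) (T : set R) (t : R) : R :=
  let S := [set s | T s /\ t < s] in
  if S == set0 then sup T else inf S.

Definition backward_jump (R : realType) (T : set R) (t : R) : R :=
  let S := [set s | T s /\ s < t] in
  if S == set0 then inf T else sup S.

Definition ts_kappa (R : realType) (T : set R) : set R :=
  T `\` [set M | [/\ T M, ubound T M & backward_jump T M < M]].

(* A relation between f, t and the value l of the derivative: it determines l
   for t in [ts_kappa T], except in the degenerate case where T is a singleton,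
   in which every l is a derivative. *)
Definition is_delta_derive (R : realType) (T : set R) (f : R -> R) (t l : R)
    : Prop :=
  forall e : R, 0 < e ->
    \forall s \near t, T s ->
      `| f (forward_jump T t) - f s - l * (forward_jump T t - s) |
        <= e * `| forward_jump T t - s |.

Definition delta_antiderivative (R : realType) (T : set R) (F f : R -> R)
    : Prop :=
  forall t, ts_kappa T t -> is_delta_derive T F t (f t).

Definition is_delta_integral (R : realType) (T : set R) (f : R -> R)
    (a b v : R) : Prop :=
  exists F : R -> R,
    delta_antiderivative (T `&` `[a, b]%classic) F f /\ v = F b - F a.

(* For a and b in T, meaningful when f is continuous on the part of T lying
   between a and b; 0 is a junk value, taken when f has no
   antiderivative there. *)
Definition delta_integral (R : realType) (T : set R) (f : R -> R) (a b : R)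
    : R :=
  if a <= b then xget 0 [set v | is_delta_integral T f a b v]
  else - xget 0 [set v | is_delta_integral T f b a v].

(* Meaningful for t in T with 0 < t, provided that T contains 1. *)
Definition ts_ln (R : realType) (T : set R) (t : R) : R :=
  delta_integral T (fun x => x^-1) 1 t.

Definition ts_scale_div (R : realType) (T : set R) (a : R) : set R :=
  [set t / a | t in T].

(* Main.v *)
Require Import Defs.
From mathcomp Require Import all_boot all_order all_algebra.
From mathcomp Require Import all_classical all_reals all_analysis.
From mathcomp Require Import ring lra.
Set Implicit Arguments.
Unset Strict Implicit.
Unset Printing Implicit Defensive.
Import Order.TTheory GRing.Theory Num.Theory.
Import numFieldNormedType.Exports.
Local Open Scope classical_set_scope.
Local Open Scope ring_scope.

(** The identity is the additivity of the integral of 1/x, from 1 to ab through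
    a, combined with the substitution x = a u, under which the delta
    integral of 1/x on T from a to ab becomes the one of 1/u on T/a from 1
    to b. The substance lies in producing an antiderivative with which both
    steps can be carried out.

    A delta antiderivative on T need not restrict to one on an interval
    [c, d] of T: if d is left-dense in T but right-scattered, the delta
    derivative at d only records the jump to the right, whereas on the interval
    it is a genuine left derivative. A stronger notion is therefore used,
    [rectangle_primitive]: for s < t in the time scale, F t - F s lies between
    the areas f t (t - s) and f s (t - s) of the right and left rectangles, and
    equals the left one when no point lies in between. This notion visibly
    restricts to intervals ([rectangle_primitiveS]) and behaves well
    under scaling ([rectangle_primitive_inv_scale]), and for continuous f it
    implies being a delta antiderivative ([rectangle_primitive_delta]).

    Existence ([rectangle_primitive_exists]) uses no partitions: when f is
    nonincreasing, F is the largest function starting at a nonpositive value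
    whose increments are bounded by the left rectangles. The supremum of all
    such functions is again one, and the lower bounds on its increments come
    from competitors glued from F and a primitive of f on the real
    line, which is the logarithm for f = 1/x.

    Uniqueness of the value of the integral ([delta_antiderivative_unique])
    comes from the fact that a vanishing delta derivative forces the end values
    to agree ([delta_antiderivative0_const]), by induction along the
    time scale. Together these give the integral between any two points,
    in either order, as a difference of values of one function F
    ([delta_integralE]), and the theorem becomes
    F (ab) - F 1 = (F a - F 1) + (F (ab) - F a). *)

(** * Suprema, infima and jump operators in closed sets *)

Lemma closed_sup (R : realType) (K S : set R) :
  closed K -> S `<=` K -> S !=set0 -> has_ubound S -> K (sup S).
Proof.
move=> clK SK S0 uS; rewrite (closure_id K).1 //.
by apply: (closureS SK); exact: closure_sup.
Qed.

Lemma closed_inf (R : realType) (K S : set R) :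
  closed K -> S `<=` K -> S !=set0 -> has_lbound S -> K (inf S).
Proof.
move=> clK SK S0 lS; rewrite (closure_id K).1 // => B /nbhs_ballP[e /= e0 eB].
have [x Sx xe] := inf_adherent e0 (conj S0 lS).
exists x; split; first exact: SK.
apply: eB; rewrite /ball/= distrC ger0_norm; first by rewrite ltrBlDl.
by rewrite subr_ge0; apply: ge_inf.
Qed.

Lemma forward_jumpP (R : realType) (K : set R) (b t : R) :
    closed K -> K b -> ubound K b -> K t ->
  [/\ K (forward_jump K t), t <= forward_jump K t
    & forall s, K s -> t < s -> forward_jump K t <= s].
Proof.
move=> clK Kb ubK Kt; rewrite /forward_jump.
have uK : has_ubound K by exists b.
have lS : lbound [set s | K s /\ t < s] t by move=> x [_ /ltW].
case: ifPn => [/eqP S0|/set0P S0]; split.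
- by apply: closed_sup => //; exists b.
- exact: ub_le_sup.
- by move=> s Ks ts; have : [set s | K s /\ t < s] s by []; rewrite S0.
- by apply: closed_inf => // [x []//|]; exists t.
- exact: lb_le_inf.
- by move=> s Ks ts; apply: ge_inf => //; exists t.
Qed.

Lemma le_forward_jump (R : realType) (K : set R) (t u y : R) :
    K u -> t < u -> (forall s, K s -> t < s -> y <= s) ->
  y <= forward_jump K t.
Proof.
move=> Ku tu leS; rewrite /forward_jump.
have Su : [set s | K s /\ t < s] u by [].
case: ifPn => [/eqP S0|_]; first by rewrite S0 in Su.
by apply: lb_le_inf => [|s [Ks ts]]; [exists u|exact: leS].
Qed.

Lemma backward_jump_le (R : realType) (K : set R) (t u y : R) :
    K u -> u < t -> (forall s, K s -> s < t -> s <= y) ->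
  backward_jump K t <= y.
Proof.
move=> Ku ut Sle; rewrite /backward_jump.
have Su : [set s | K s /\ s < t] u by [].
case: ifPn => [/eqP S0|_]; first by rewrite S0 in Su.
by apply: ge_sup => [|s [Ks st]]; [exists u|exact: Sle].
Qed.

Lemma backward_jumpP (R : realType) (K : set R) (a t : R) :
    closed K -> K a -> a < t ->
  [/\ K (backward_jump K t), backward_jump K t <= t
    & forall s, K s -> s < t -> s <= backward_jump K t].
Proof.
move=> clK Ka at_; rewrite /backward_jump.
have uS : ubound [set s | K s /\ s < t] t by move=> x [_ /ltW].
have Sa : [set s | K s /\ s < t] a by [].
case: ifPn => [/eqP S0|_]; first by rewrite S0 in Sa.
split.
- by apply: closed_sup => // [x []//||]; [exists a|exists t].
- by apply: ge_sup => //; exists a.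
- by move=> s Ks st; apply: ub_le_sup => //; exists t.
Qed.

Lemma kappa_lt (R : realType) (K : set R) (s t : R) :
  K s -> K t -> s < t -> ts_kappa K s.
Proof. by move=> Ks Kt st; split=> // -[_ /(_ t Kt)]; rewrite leNgt st. Qed.

(** * Uniqueness of antiderivatives *)

(** It suffices to bound |H t - H a| by e (t - a) for every e > 0. Let c be the
    infimum of the points where this bound fails. If it holds at c, then c is
    right-dense and the derivative at c propagates the bound to the right. If
    it fails at c, either c is the forward jump of a point where the bound
    holds, and the derivative at that point gives it at c, or c is left-dense
    and H, being continuous at c, inherits the bound from the left. *)
Lemma delta_antiderivative0_const (R : realType) (K : set R) (H : R -> R)
    (a b : R) :
    closed K -> K a -> K b -> lbound K a -> ubound K b ->
    delta_antiderivative K H (fun=> 0) ->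
  H b = H a.
Proof.
move=> clK Ka Kb lK uK dH.
have dH0 t e : ts_kappa K t -> 0 < e -> \forall s \near t, K s ->
    `|H (forward_jump K t) - H s| <= e * `|forward_jump K t - s|.
  move=> /dH Ht /Ht; apply: filterS => s /[apply].
  by rewrite mul0r subr0.
suff le_e e : 0 < e -> `|H b - H a| <= e * (b - a).
  have ab0 : 0 <= b - a by rewrite subr_ge0 lK.
  apply/eqP; rewrite -subr_eq0 -normr_le0; apply/ler_addgt0Pr => e e0.
  have d0 : 0 < b - a + 1 by lra.
  have := le_e _ (divr_gt0 e0 d0); rewrite add0r => /le_trans; apply.
  by rewrite mulrAC ler_pdivrMr // ler_pM2l //; lra.
move=> e0; rewrite leNgt; apply/negP => badb.
pose bad := [set t | K t /\ e * (t - a) < `|H t - H a|].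
have bad0 : bad !=set0 by exists b.
have lbad : has_lbound bad by exists a => x [/lK].
set c := inf bad.
have Kc : K c by apply: closed_inf => // x [].
have goodP s : K s -> s < c -> `|H s - H a| <= e * (s - a).
  move=> Ks sc; rewrite leNgt; apply/negP => bs.
  have : c <= s by apply: ge_inf.
  by rewrite leNgt sc.
have [Kj cj jP] := forward_jumpP clK Kb uK Kc.
have [goodc|badc] := leP `|H c - H a| (e * (c - a)).
  have cltbad s : bad s -> c < s.
    move=> bs; rewrite lt_neqAle ge_inf // andbT; apply/eqP => cs.
    by case: bs => _; rewrite -cs ltNge goodc.
  have cb : c < b by exact: cltbad.
  (* c is a limit of bad points strictly above it, hence right-dense. *)
  have jc : forward_jump K c = c.
    apply/eqP; rewrite eq_le cj andbT.
    by apply: lb_le_inf => // s bs; apply: jP; [case: bs|exact: cltbad].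
  have /nbhs_ballP[d /= d0 dP] := dH0 _ e (kappa_lt Kc Kb cb) e0.
  have [s bs sd] := inf_adherent d0 (conj bad0 lbad).
  have cs := cltbad _ bs; case: (bs) => Ks.
  have := dP s _ Ks; rewrite jc (distrC c) (gtr0_norm (x := s - c)) ?subr_gt0 //.
  have sball : ball c d s.
    by rewrite /ball/= distrC gtr0_norm ?subr_gt0 // ltrBlDl.
  move=> /(_ sball); rewrite distrC => le1.
  have := ler_distD (H c) (H s) (H a); lra.
have ac : a < c.
  rewrite lt_neqAle lK // andbT; apply/eqP => ac.
  by move: badc; rewrite -ac !subrr normr0 mulr0 ltxx.
have [Kp pc pP] := backward_jumpP clK Ka ac.
move: pc; rewrite le_eqVlt => /predU1P[pc|pc]; last first.
  (* c is left-scattered: p and c are consecutive points of K. *)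
  set p := backward_jump K c in Kp pc pP.
  have [Kjp pj jpP] := forward_jumpP clK Kb uK Kp.
  have jp : forward_jump K p = c.
    apply/eqP; rewrite eq_le jpP //=.
    apply: (le_forward_jump Kc pc) => s Ks ps; rewrite leNgt; apply/negP => sc.
    by move: (pP s Ks sc); rewrite leNgt ps.
  have := nbhs_singleton (dH0 _ e (kappa_lt Kp Kc pc) e0) Kp.
  rewrite jp (gtr0_norm (x := c - p)) ?subr_gt0 // => le1.
  have := goodP _ Kp pc; have := ler_distD (H p) (H c) (H a); lra.
(* c is left-dense. If c is also right-scattered, the derivative at c controls
   H s only through the value at the forward jump, so H s and H c are both
   compared with that value; e' makes each comparison cost at most half of the
   excess x - e (c - a). *)
have kc : ts_kappa K c by split=> // -[_ _]; rewrite pc ltxx.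
set x := `|H c - H a| in badc *.
have ab : a < b by apply: lt_le_trans ac (uK _ Kc).
pose e' := (x - e * (c - a)) / (2 * (b - a)).
have e'0 : 0 < e' by rewrite divr_gt0 // ?mulr_gt0 // subr_gt0.
have e'E : e' * (b - a) = (x - e * (c - a)) / 2.
  by rewrite /e'; field; rewrite subr_eq0 gt_eqF.
have /nbhs_ballP[d /= d0 dP] := dH0 c e' kc e'0.
have [s [Ks sc ds]] : exists s, [/\ K s, s < c & c - d < s].
  apply: contrapT => nos.
  have : backward_jump K c <= c - d.
    apply: (backward_jump_le Ka ac) => s Ks sc; rewrite leNgt; apply/negP => ds.
    by apply: nos; exists s.
  by rewrite pc; lra.
have leh u : K u -> u <= c -> ball c d u ->
    `|H (forward_jump K c) - H u| <= (x - e * (c - a)) / 2.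
  move=> Ku uc /dP /(_ Ku) /le_trans; apply.
  rewrite -e'E ler_pM2l // ger0_norm ?subr_ge0 ?(le_trans uc) //.
  by apply: lerB; [exact: uK|exact: lK].
have hs := leh s Ks (ltW sc); have hc := leh c Kc (lexx _) (ballxx _ d0).
have {}hs : `|H (forward_jump K c) - H s| <= (x - e * (c - a)) / 2.
  by apply: hs; rewrite /ball/= gtr0_norm ?subr_gt0 //; lra.
have hsa := goodP s Ks sc.
have := ler_distD (H s) (H c) (H a).
have := ler_distD (H (forward_jump K c)) (H c) (H s).
rewrite (distrC (H c) (H (forward_jump K c))) -/x => h1 h2.
have : e * (s - a) < e * (c - a) by rewrite ltr_pM2l // ltrD2r.
lra.
Qed.

(** * Primitives controlled by rectangles *)

(** The third clause is what makes F right at right-scattered points, where the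
    delta integral over the gap is exactly the left rectangle. *)
Definition rectangle_primitive (R : realType) (K : set R) (f F : R -> R)
    : Prop :=
  forall s t, K s -> K t -> s < t ->
    [/\ f t * (t - s) <= F t - F s, F t - F s <= f s * (t - s)
      & (forall u, K u -> s < u -> t <= u) -> F t - F s = f s * (t - s)].

(** F is the pointwise largest function with F m <= 0 whose increments are at
    most those of the left rectangles. Its increments are large enough because
    F must dominate the function that follows F up to a point s, makes the jump
    f s (s' - s) allowed across a gap from s to s', and then follows phi;
    taking s' = s gives the lower rectangle bound, and a true gap gives the
    exact value. *)
Lemma rectangle_primitive_exists (R : realType) (K : set R)
    (f phi : R -> R) (m : R) :
    K m -> lbound K m ->
    (forall s t, K s -> K t -> s <= t -> f t <= f s) ->
    (forall s t, K s -> K t -> s <= t ->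
       f t * (t - s) <= phi t - phi s <= f s * (t - s)) ->
  exists F, rectangle_primitive K f F.
Proof.
move=> Km lK fdecr phiP.
pose sub G := G m <= 0 /\
  forall s t, K s -> K t -> s <= t -> G t - G s <= f s * (t - s).
pose values t := [set G t | G in [set G : R -> R | sub G]].
pose F t := sup (values t).
have subphi : sub (fun t => phi t - phi m).
  split=> [|s t Ks Kt st]; first by rewrite subrr.
  by have /andP[_] := phiP s t Ks Kt st; lra.
have ubF t : K t -> has_ubound (values t).
  move=> Kt; exists (f m * (t - m)) => _ [G [Gm subG] <-].
  by have := subG m t Km Kt (lK _ Kt); lra.
have geF G t : K t -> sub G -> G t <= F t.
  by move=> Kt sG; apply: ub_le_sup; [exact: ubF|exists G].
have leF t y : (forall G, sub G -> G t <= y) -> F t <= y.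
  move=> Gy; apply: ge_sup; last by move=> _ [G sG <-]; exact: Gy.
  by exists (phi t - phi m), (fun t => phi t - phi m).
have subF : sub F.
  split=> [|s t Ks Kt st]; first by apply: leF => G [].
  rewrite lerBlDr; apply: leF => G sG.
  have := geF G s Ks sG; have [_ /(_ s t Ks Kt st)] := sG; lra.
have glue s s' t : K s -> K s' -> s <= s' -> K t -> s' <= t ->
    (forall u, K u -> s < u -> s' <= u) ->
    F s + f s * (s' - s) + (phi t - phi s') <= F t.
  move=> Ks Ks' ss' Kt s't gap.
  pose G u := if u <= s then F u else F s + f s * (s' - s) + (phi u - phi s').
  have sG : sub G.
    split=> [|u v Ku Kv uv]; rewrite /G; first by rewrite lK //; case: subF.
    have [vs|sv] := leP v s.
      by rewrite (le_trans uv vs); case: subF => _; apply.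
    have s'v := gap v Kv sv.
    have [us|su] := leP u s.
      have /andP[_ h1] := phiP _ _ Ks' Kv s'v.
      have [_ /(_ u s Ku Ks us) h2] := subF.
      have h3 : f s' * (v - s') <= f u * (v - s').
        by rewrite ler_wpM2r ?subr_ge0 // fdecr // (le_trans us).
      have h4 : f s * (s' - s) <= f u * (s' - s).
        by rewrite ler_wpM2r ?subr_ge0 // fdecr.
      lra.
    by have /andP[_] := phiP u v Ku Kv uv; lra.
  apply: le_trans (geF G t Kt sG); rewrite /G.
  have [ts|//] := leP t s.
  have -> : s' = t by apply/eqP; rewrite eq_le s't (le_trans ts).
  have -> : s = t by apply/eqP; rewrite eq_le ts (le_trans ss').
  lra.
exists F => s t Ks Kt st; have st' := ltW st; have [_ subF'] := subF; split.
- have /andP[+ _] := phiP s t Ks Kt st'.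
  have := glue s s t Ks Ks (lexx _) Kt st' (fun u _ => @ltW _ _ s u); lra.
- exact: subF'.
- move=> gap; have := glue s t t Ks Kt st' Kt (lexx _) gap.
  by have := subF' s t Ks Kt st'; lra.
Qed.

(** The first hypothesis says that K' is order-convex in K, so that a gap of K'
    is a gap of K. *)
Lemma rectangle_primitiveS (R : realType) (K K' : set R) (f F : R -> R) :
    (forall s t u, K' s -> K' t -> K u -> s < u < t -> K' u) -> K' `<=` K ->
  rectangle_primitive K f F -> rectangle_primitive K' f F.
Proof.
move=> cvx K'K FP s t Ks Kt st.
have [h1 h2 h3] := FP s t (K'K _ Ks) (K'K _ Kt) st.
split=> // gap; apply: h3 => u Ku su; rewrite leNgt; apply/negP => ut.
have : t <= u by apply: gap => //; apply: (cvx s t) => //; rewrite su.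
by rewrite leNgt ut.
Qed.

(** For s near t, f s is close to f t, so the rectangle bounds put F t - F s
    within e |t - s| of f t (t - s). The increment from t to its forward jump j
    is exact and contributes no error, and |t - s| <= |j - s| since s
    near t in K cannot lie beyond t when t < j. *)
Lemma rectangle_primitive_delta (R : realType) (K : set R) (f F : R -> R)
    (b : R) :
    closed K -> K b -> ubound K b ->
    (forall t, K t -> {for t, continuous f}) ->
  rectangle_primitive K f F -> delta_antiderivative K F f.
Proof.
move=> clK Kb uK fc FP t [Kt _] e e0.
have [Kj tj jP] := forward_jumpP clK Kb uK Kt.
set j := forward_jump K t in Kj tj jP *.
have FtE : F j - F t = f t * (j - t).
  move: tj; rewrite le_eqVlt => /predU1P[<-|tj]; first by rewrite !subrr mulr0.
  by have [_ _] := FP t j Kt Kj tj; apply.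
have near_le s : K s -> `|f t - f s| <= e ->
    `|F t - F s - f t * (t - s)| <= e * `|t - s|.
  move=> Ks; rewrite ler_distl => /andP[fl fu].
  have [st|ts|<-] := ltgtP s t; last by rewrite !subrr mulr0 subrr normr0 mulr0.
  - have d0 : 0 < t - s by rewrite subr_gt0.
    have [lo hi _] := FP s t Ks Kt st.
    have h : f s * (t - s) <= (f t + e) * (t - s) by rewrite ler_pM2r //; lra.
    by rewrite (gtr0_norm d0) ler_norml; apply/andP; split; nra.
  - have d0 : 0 < s - t by rewrite subr_gt0.
    have [lo hi _] := FP t s Kt Ks ts.
    have h : (f t - e) * (s - t) <= f s * (s - t) by rewrite ler_pM2r //; lra.
    by rewrite distrC (distrC t) (gtr0_norm d0) ler_norml; apply/andP; split; nra.
have fnear : \forall s \near t, `|f t - f s| <= e.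
  by move: (fc t Kt) => /cvgrPdist_le /(_ e e0).
have snear : \forall s \near t, t < j -> s < j.
  move: tj; rewrite le_eqVlt => /predU1P[<-|tj].
    by near=> s; rewrite ltxx.
  by apply: filterS (lt_nbhsl tj) => s.
near=> s => Ks.
have /(near_le s Ks) le_s : `|f t - f s| <= e by near: s.
have -> : F j - F s - f t * (j - s) = F t - F s - f t * (t - s).
  by lra.
apply: le_trans le_s _; rewrite ler_pM2l //.
have [st|ts] := leP s t.
  rewrite !ger0_norm ?subr_ge0 //; lra.
have jj := jP s Ks ts.
have : t < j -> s < j by near: s.
move: tj; rewrite le_eqVlt => /predU1P[<- _ //|tj /(_ tj)].
by rewrite ltNge jj.
Unshelve. all: by end_near. Qed.

(** * The delta integral as a difference of values *)

Lemma delta_antiderivative_unique (R : realType) (K : set R) (f F G : R -> R)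
    (a b : R) :
    closed K -> K a -> K b -> lbound K a -> ubound K b ->
    delta_antiderivative K F f -> delta_antiderivative K G f ->
  F b - F a = G b - G a.
Proof.
move=> clK Ka Kb lK uK dF dG.
suff : F b - G b = F a - G a by lra.
apply: (@delta_antiderivative0_const _ K (fun x => F x - G x)) => // t kt e e0.
have e20 : 0 < e / 2 by rewrite divr_gt0.
near=> s => Ks; set j := forward_jump K t.
have hF : `|F j - F s - f t * (j - s)| <= e / 2 * `|j - s|.
  by move: (Ks); near: s; exact: (dF t kt).
have hG : `|G j - G s - f t * (j - s)| <= e / 2 * `|j - s|.
  by move: (Ks); near: s; exact: (dG t kt).
rewrite mul0r subr0.
have -> : F j - G j - (F s - G s) =
  F j - F s - f t * (j - s) - (G j - G s - f t * (j - s)) by lra.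
by apply: le_trans (ler_normB _ _) _; lra.
Unshelve. all: by end_near. Qed.

(** One function F serves all intervals above m at once, which is what makes
    additivity immediate. *)
Lemma delta_integralE (R : realType) (T : set R) (f F : R -> R) (m c d : R) :
    closed T -> T c -> T d -> m <= c -> m <= d ->
    (forall t, T t -> m <= t -> {for t, continuous f}) ->
    rectangle_primitive (T `&` [set t | m <= t]) f F ->
  delta_integral T f c d = F d - F c.
Proof.
move=> clT Tc Td mc md fc FP.
have le_case x y : T x -> T y -> m <= x -> x <= y ->
    xget 0 [set v | is_delta_integral T f x y v] = F y - F x.
  move=> Tx Ty mx xy.
  set K := T `&` `[x, y]%classic.
  have clK : closed K by apply: closedI => //; exact: itv_closed.
  have Kx : K x by split=> //=; rewrite in_itv/= lexx.
  have Ky : K y by split=> //=; rewrite in_itv/= lexx xy.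
  have lK : lbound K x by move=> u [_]; rewrite /= in_itv/= => /andP[].
  have uK : ubound K y by move=> u [_]; rewrite /= in_itv/= => /andP[].
  have dF : delta_antiderivative K F f.
    apply: (rectangle_primitive_delta clK Ky uK).
      by move=> t Kt; apply: fc; [case: Kt|exact: le_trans (lK _ Kt)].
    apply: rectangle_primitiveS FP => [s t u Ks Kt [Tu _] /andP[su ut]|].
      split=> //=; rewrite in_itv/=; apply/andP; split.
        exact: le_trans (lK _ Ks) (ltW su).
      exact: le_trans (ltW ut) (uK _ Kt).
    by move=> u Ku; split; [case: Ku|exact: le_trans (lK _ Ku)].
  apply: xget_unique; first by exists F; split.
  move=> v [G [dG ->]].
  exact: (delta_antiderivative_unique clK Kx Ky lK uK dG dF).
rewrite /delta_integral; have [cd|/ltW dc] := leP c d; first exact: le_case.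
by rewrite le_case // opprB.
Qed.

(** * The logarithm *)

(** Both bounds are the tangent inequality for the concave function ln, taken
    at s and at t. *)
Lemma ln_slope (R : realType) (s t : R) : 0 < s -> s <= t ->
  t^-1 * (t - s) <= ln t - ln s <= s^-1 * (t - s).
Proof.
have ln_le (x y : R) : 0 < x -> 0 < y -> ln y - ln x <= x^-1 * (y - x).
  move=> x0 y0; rewrite -ln_div ?posrE //.
  have -> : y / x = 1 + x^-1 * (y - x) by field; rewrite gt_eqF.
  apply: le_ln1Dx; rewrite mulrBr mulVf ?gt_eqF //.
  by rewrite -subr_gt0 opprK subrK mulr_gt0 ?invr_gt0.
move=> s0 st; have t0 := lt_le_trans s0 st.
by rewrite ln_le // andbT; have := ln_le t s t0 s0; lra.
Qed.

(** The area (t - s) / s of a rectangle under 1/x is invariant under scaling. *)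
Lemma rectangle_primitive_inv_scale (R : realType) (K : set R)
    (F : R -> R) (a : R) : 0 < a ->
  rectangle_primitive K (fun x => x^-1) F ->
  rectangle_primitive [set t | K (a * t)] (fun x => x^-1) (fun t => F (a * t)).
Proof.
move=> a0 FP s t Ks Kt st.
have scale u : (a * u)^-1 * (a * t - a * s) = u^-1 * (t - s).
  by rewrite -mulrBr invfM mulrACA mulVf ?mul1r // gt_eqF.
have [] := FP (a * s) (a * t) Ks Kt; first by rewrite ltr_pM2l.
rewrite !scale => h1 h2 h3; split=> // gap; apply: h3 => u Ku su.
have uE : a * (u / a) = u by rewrite mulrCA mulfV ?mulr1 // gt_eqF.
by rewrite -uE ler_pM2l // gap /= ?uE // -(ltr_pM2l a0) uE.
Qed.

Theorem theorem4 (R : realType) (T : set R)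
  (hT : time_scale T) (h1 : T 1)
  (hne : exists t : R, [/\ T t, 0 < t & t != 1])
  (a : R) (haT : T a) (ha : 0 < a)
  (b : R) (hb : 0 < b) (habT : T (a * b)) :
  ts_ln T (a * b) = ts_ln T a + ts_ln (ts_scale_div T a) b.
Proof.
have [_ clT] := hT.
have [m [m0 Tm m1 ma mab]] : exists m, [/\ 0 < m, T m, m <= 1, m <= a & m <= a * b].
  have ab0 := mulr_gt0 ha hb.
  exists (Num.min 1 (Num.min a (a * b))); split.
  - by rewrite !lt_min ltr01 ha.
  - by rewrite /Num.min; do 2?case: ifP.
  - by rewrite ge_min lexx.
  - by rewrite !ge_min lexx orbT.
  - by rewrite !ge_min lexx !orbT.
have [||s t [_ ms] _ st|s t [_ ms] _ st|F FP] :=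
  @rectangle_primitive_exists R (T `&` [set t | m <= t])
    (fun x => x^-1) (@ln R) m.
- by split=> /=.
- by move=> t [].
- by rewrite lef_pV2 ?posrE // (lt_le_trans m0) // (le_trans ms).
- exact/ln_slope/st/lt_le_trans/ms.
have aN0 : a != 0 by rewrite gt_eqF.
have TaE : ts_scale_div T a = [set t | T (a * t)].
  apply/seteqP; split=> [_ [t Tt <-]|t Tt] /=; first by rewrite mulrCA mulfV ?mulr1.
  by exists (a * t) => //; rewrite mulrAC mulfV ?mul1r.
have lnT t : T t -> m <= t -> ts_ln T t = F t - F 1.
  move=> Tt mt; apply: (delta_integralE clT h1 Tt m1 mt _ FP) => u Tu mu.
  by apply: inv_continuous; rewrite gt_eqF // (lt_le_trans m0).
have lnTa : ts_ln (ts_scale_div T a) b = F (a * b) - F a.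
  have ma0 : 0 < m / a by rewrite divr_gt0.
  (* F a is the value at 1 of t |-> F (a t). *)
  rewrite TaE -{3}(mulr1 a).
  apply: (@delta_integralE _ _ _ (fun t => F (a * t)) (m / a)) => /=.
  - by apply: (closed_comp _ clT) => x _; exact: mulrl_continuous.
  - by rewrite mulr1.
  - by [].
  - by rewrite ler_pdivrMr ?mul1r.
  - by rewrite ler_pdivrMr // mulrC.
  - by move=> u _ mu; apply: inv_continuous; rewrite gt_eqF // (lt_le_trans ma0).
  have := rectangle_primitive_inv_scale ha FP; congr rectangle_primitive.
  by apply/seteqP; split=> t /= []; rewrite ler_pdivrMr // (mulrC t).
rewrite !lnT // lnTa; lra.
Qed.
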